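(* Assume (QP) has an optimal solution, let $\gamma\in(0,1)$, and let $\tau_p,\tau_d>0$ be problem-dependent error bound constants for (QP) (as defined in the context). Put $C_2=\sqrt{n/\gamma}+n$. Let $$\psi=\min\left(\inf_{x^*\in\Omega_P}\ \min_{i\in\mathcal{I}(x^* )}x_i^*,\ \inf_{(y^*,s^* )\in\Omega_D}\ \min_{i\in\mathcal{S}(s^* )}s_i^*\right),$$ where $\Omega_P$ and $\Omega_D$ are the solution sets of the primal and the dual problem in (QP), respectively, and assume $\psi>0$. Fix $C$ and a vector $\lambda\in\mathbb{R}^n$, $\lambda\ge0$, such that $$C=\frac{\psi}{2}\quad\text{and}\quad 0<\|\lambda\|<\min\left(1,\ \frac{\psi}{16\max(\tau_p,\tau_d)}\right).$$ Let $(x,y,s)\in\mathcal{N}_\lambda(\gamma)$ with $$0<\mu_\lambda<\min\left(1,\ \left(\frac{\psi}{4\max(\tau_p,\tau_d)\,C_2}\right)^2\right).$$ Then there exists an optimal solution $(x^*,y^*,s^* )$ of (QP) such that $$\bar{\mathcal{S}}_C(s)=\mathcal{S}(s^* ),\qquad \bar{\mathcal{I}}_C(x)=\mathcal{I}(x^* ),\qquad \bar{\mathcal{T}}_C(x,s)=\mathcal{T}(x^*,s^* ).$$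
   Context: Let $H\in\mathbb{R}^{n\times n}$ be symmetric positive semidefinite, $A\in\mathbb{R}^{m\times n}$ with $m\le n$, $b\in\mathbb{R}^m$, $c\in\mathbb{R}^n$. Vector inequalities are componentwise and $\|\cdot\|$ is the Euclidean norm. The pair (QP) consists of the primal problem $\min_x \frac12x^THx+c^Tx$ subject to $Ax=b$, $x\ge0$, and the dual problem $\max_{(x,y,s)} b^Ty-\frac12x^THx$ subject to $A^Ty+s-Hx=c$, $s\ge0$, $y$ free. A triple $(x^*,y^*,s^* )$ is an optimal solution of (QP) if and only if $Ax^*=b$, $A^Ty^*+s^*-Hx^*=c$, $x^*\ge0$, $s^*\ge0$ and $x_i^*s_i^*=0$ for all $i$. The dual solution set $\Omega_D$ is regarded as the set of pairs $(y^*,s^* )$ for which $(x,y^*,s^* )$ is an optimal solution of the dual problem for some $x$. For $\lambda\ge0$, $\mathcal{F}^0_\lambda=\{(x,y,s): Ax=b,\ A^Ty+s-Hx=c,\ x+\lambda>0,\ s+\lambda>0\}$. For a triple $(x,y,s)$, $\mu_\lambda=\frac{(x+\lambda)^T(s+\lambda)}{n}$. For $\gamma\in(0,1)$, $\mathcal{N}_\lambda(\gamma)=\{(x,y,s)\in\mathcal{F}^0_\lambda: \gamma\mu_\lambda\le(x_i+\lambda_i)(s_i+\lambda_i)\le\mu_\lambda/\gamma,\ i=1,\dots,n\}$. Problem-dependent error bound constants: $\tau_p,\tau_d>0$ are constants depending only on $(H,A,b,c)$ such that for every $\gamma\in(0,1)$, every $\lambda\ge0$ and every $(x,y,s)\in\mathcal{N}_\lambda(\gamma)$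 there is an optimal solution $(x^*,y^*,s^* )$ of (QP) with $\|x-x^*\|<\tau_p\,\beta$ and $\|s-s^*\|<\tau_d\,\beta$, where $\beta=(\sqrt{n/\gamma}+n)\sqrt{\mu_\lambda}\max(\sqrt{\mu_\lambda},1)+4\|\lambda\|\max(\|\lambda\|,1)$. (Such constants exist when (QP) has an optimal solution.) Sets (with $i$ ranging over $\{1,\dots,n\}$): $\mathcal{I}(x^* )=\{i:x_i^*>0\}$, $\mathcal{S}(s^* )=\{i:s_i^*>0\}$, $\mathcal{T}(x^*,s^* )=\{1,\dots,n\}\setminus(\mathcal{S}(s^* )\cup\mathcal{I}(x^* ))$; $\bar{\mathcal{I}}_C(x)=\{i:x_i\ge C\}$, $\bar{\mathcal{S}}_C(s)=\{i:s_i\ge C\}$, $\bar{\mathcal{T}}_C(x,s)=\{1,\dots,n\}\setminus(\bar{\mathcal{S}}_C(s)\cup\bar{\mathcal{I}}_C(x))$. Convention: a minimum over the empty set is $+\infty$, and quantities involving $\psi$ are read in $[0,+\infty]$. *)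

(* Defs.v *)
From HB Require Import structures.
From mathcomp Require Import all_boot all_order all_algebra.
From mathcomp Require Import all_classical all_reals ereal.

Set Implicit Arguments.
Unset Strict Implicit.
Unset Printing Implicit Defensive.

Import Order.TTheory GRing.Theory Num.Theory.

Local Open Scope classical_set_scope.
Local Open Scope ring_scope.

Section Vectors.
Variables (R : realType) (n : nat).
Implicit Types (u v x s lam : 'cV[R]_n) (H : 'M[R]_n).

Definition dotv u v : R := (u^T *m v) 0 0.

(* The Euclidean norm; the library norm on matrices is the sup norm. *)
Definition enorm u : R := Num.sqrt (dotv u u).

Definition nonneg u : Prop := forall i, 0 <= u i 0.

Definition positive u : Prop := forall i, 0 < u i 0.

Definition sym_psd H : Prop := H^T = H /\ forall v, 0 <= dotv v (H *m v).

Definition mu lam x s : R := dotv (x + lam) (s + lam) / n%:R.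

(* i with u_i > 0: this is I(x) for u = x and S(s) for u = s. *)
Definition pos_idx u : {set 'I_n} := [set i | 0 < u i 0]%SET.

Definition zero_idx x s : {set 'I_n} :=
  ([set: 'I_n] :\: (pos_idx s :|: pos_idx x))%SET.

(* The threshold is extended real, since it is allowed to be +oo; again one
   definition serves for both the x-sets and the s-sets. *)
Definition ge_idx (C : \bar R) u : {set 'I_n} :=
  [set i | (C <= (u i 0)%:E)%E]%SET.

Definition lt_idx (C : \bar R) x s : {set 'I_n} :=
  ([set: 'I_n] :\: (ge_idx C s :|: ge_idx C x))%SET.

(* The least positive entry of u, +oo if there is none. *)
Definition min_pos u : \bar R :=
  \big[mine/+oo%E]_(i in pos_idx u) (u i 0)%:E.

Definition C2 (gamma : R) : R := Num.sqrt (n%:R / gamma) + n%:R.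

Definition beta (gamma : R) lam x s : R :=
  C2 gamma * Num.sqrt (mu lam x s) * Num.max (Num.sqrt (mu lam x s)) 1
  + 4 * enorm lam * Num.max (enorm lam) 1.

End Vectors.

Section QuadraticProgram.
Variables (R : realType) (m n : nat).
Variables (H : 'M[R]_n) (A : 'M[R]_(m, n)) (b : 'cV[R]_m) (c : 'cV[R]_n).
Implicit Types (x s lam : 'cV[R]_n) (y : 'cV[R]_m).

Definition primal_feasible x : Prop := A *m x = b /\ nonneg x.

Definition primal_obj x : R := 2^-1 * dotv x (H *m x) + dotv c x.

Definition primal_optimal x : Prop :=
  primal_feasible x /\
  forall x', primal_feasible x' -> primal_obj x <= primal_obj x'.

Definition dual_feasible x y s : Prop :=
  A^T *m y + s - H *m x = c /\ nonneg s.

Definition dual_obj x y : R := dotv b y - 2^-1 * dotv x (H *m x).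

Definition dual_optimal x y s : Prop :=
  dual_feasible x y s /\
  forall x' y' s', dual_feasible x' y' s' -> dual_obj x' y' <= dual_obj x y.

Definition Omega_P : set 'cV[R]_n := [set x | primal_optimal x].

(* The x-component of a dual solution is projected away; it need not be
   primal feasible. *)
Definition Omega_D : set ('cV[R]_m * 'cV[R]_n) :=
  [set ys | exists x, dual_optimal x ys.1 ys.2].

(* An optimal solution of the primal-dual pair, as a complementary triple. *)
Definition QP_optimal x y s : Prop :=
  [/\ A *m x = b, A^T *m y + s - H *m x = c, nonneg x, nonneg s
    & forall i, x i 0 * s i 0 = 0].

Definition F0 lam x y s : Prop :=
  [/\ A *m x = b, A^T *m y + s - H *m x = c,
      positive (x + lam) & positive (s + lam)].

Definition nbhd (gamma : R) lam x y s : Prop :=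
  F0 lam x y s /\
  forall i, gamma * mu lam x s <= (x + lam) i 0 * (s + lam) i 0
                               <= mu lam x s / gamma.

Definition error_bound_constants (taup taud : R) : Prop :=
  [/\ 0 < taup, 0 < taud &
    forall (gamma : R) lam x y s,
      0 < gamma < 1 -> nonneg lam -> nbhd gamma lam x y s ->
      exists xo yo so,
        [/\ QP_optimal xo yo so,
            enorm (x - xo) < taup * beta gamma lam x s
          & enorm (s - so) < taud * beta gamma lam x s]].

Definition psi : \bar R :=
  mine (ereal_inf [set min_pos x | x in Omega_P])
       (ereal_inf [set min_pos ys.2 | ys in Omega_D]).

End QuadraticProgram.

(* Main.v *)
(* The error bound yields an optimal triple whose x- and s-parts are within
   tau (C2 sqrt mu + 4 |lam|) < psi/4 + psi/4 = C of the given x and s.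
   Every entry of an optimal triple is either 0 or at least psi, by the
   optimality of its components for the primal and the dual problem, so that
   thresholding the nearby x and s at psi/2 recovers the supports exactly. *)
Require Import Defs.
From HB Require Import structures.
From mathcomp Require Import all_boot all_order all_algebra.
From mathcomp Require Import all_classical all_reals ereal.
From mathcomp Require Import ring lra.

Import Order.TTheory GRing.Theory Num.Theory.
Local Open Scope ring_scope.

Section Dotv.
Set Implicit Arguments.
Context {R : realType}.

Lemma dotvE n (u v : 'cV[R]_n) : dotv u v = \sum_i u i 0 * v i 0.
Proof. by rewrite /dotv mxE; apply: eq_bigr => i _; rewrite mxE. Qed.

Lemma dotvC n (u v : 'cV[R]_n) : dotv u v = dotv v u.
Proof. by rewrite !dotvE; apply: eq_bigr => i _; rewrite mulrC. Qed.

Lemma dotvDr n (u v w : 'cV[R]_n) : dotv u (v + w) = dotv u v + dotv u w.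
Proof. by rewrite /dotv mulmxDr mxE. Qed.

Lemma dotvNr n (u v : 'cV[R]_n) : dotv u (- v) = - dotv u v.
Proof. by rewrite /dotv mulmxN mxE. Qed.

Lemma dotvBr n (u v w : 'cV[R]_n) : dotv u (v - w) = dotv u v - dotv u w.
Proof. by rewrite dotvDr dotvNr. Qed.

Lemma dotvBl n (u v w : 'cV[R]_n) : dotv (v - w) u = dotv v u - dotv w u.
Proof. by rewrite dotvC dotvBr !(dotvC u). Qed.

Lemma dotv_trmx m n (M : 'M[R]_(m, n)) (u : 'cV[R]_n) (v : 'cV[R]_m) :
  dotv u (M^T *m v) = dotv (M *m u) v.
Proof. by rewrite /dotv trmx_mul mulmxA. Qed.

Lemma dotv_ge0 n (u v : 'cV[R]_n) : nonneg u -> nonneg v -> 0 <= dotv u v.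
Proof. by move=> u0 v0; rewrite dotvE sumr_ge0// => i _; rewrite mulr_ge0. Qed.

Lemma le_enorm n (u : 'cV[R]_n) i : `|u i 0| <= enorm u.
Proof.
rewrite -sqrtr_sqr; apply: ler_wsqrtr.
rewrite dotvE (bigD1 i)//= -expr2 lerDl sumr_ge0// => j _.
by rewrite -expr2 sqr_ge0.
Qed.

End Dotv.

Section Optimality.
Set Implicit Arguments.
Unset Strict Implicit.
Context {R : realType} {m n : nat}.
Variables (H : 'M[R]_n) (A : 'M[R]_(m, n)) (b : 'cV[R]_m) (c : 'cV[R]_n).
Hypothesis hH : sym_psd H.

(** Semidefiniteness at [x - x'], expanded; symmetry of [H] merges the two cross terms. *)
Lemma psd_cross x x' :
  2 * dotv x (H *m x') <= dotv x (H *m x) + dotv x' (H *m x').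
Proof.
have [Hs Hp] := hH; have := Hp (x - x').
rewrite mulmxBr !dotvBl !dotvBr.
have -> : dotv x' (H *m x) = dotv x (H *m x').
  by rewrite -{1}Hs dotv_trmx dotvC.
lra.
Qed.

(** Pairing the dual constraint with [x']. Keeping [x'] apart from the [x] of that constraint lets
    the lemma serve both against a competing primal point and against a competing dual triple. *)
Lemma dotv_c (x x' : 'cV[R]_n) (y : 'cV[R]_m) (s : 'cV[R]_n) :
  A *m x' = b -> A^T *m y + s - H *m x = c ->
  dotv x' c = dotv b y + dotv x' s - dotv x' (H *m x).
Proof. by move=> <- <-; rewrite dotvBr dotvDr dotv_trmx. Qed.

Lemma QP_optimal_gap0 x y s : QP_optimal H A b c x y s -> dotv x s = 0.
Proof. by case=> _ _ _ _ xs; rewrite dotvE big1. Qed.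

(** Weak duality: as [dotv x s = 0], the objective at [x'] exceeds that at [x] by half the [H]-form
    of [x' - x] plus [dotv x' s], both nonnegative. *)
Lemma QP_optimal_primal x y s :
  QP_optimal H A b c x y s -> primal_optimal H A b c x.
Proof.
move=> opt; have xs := QP_optimal_gap0 opt; case: opt => Ax eqc x0 s0 _.
split=> // x' [Ax' x'0]; rewrite /primal_obj !(dotvC c).
have := dotv_ge0 x'0 s0; have := psd_cross x' x.
by rewrite (dotv_c Ax eqc) (dotv_c Ax' eqc) xs; lra.
Qed.

(** Here the competitor's constraint is paired with [x]: the excess is half the [H]-form of [x - x']
    plus [dotv x s']. *)
Lemma QP_optimal_dual x y s :
  QP_optimal H A b c x y s -> dual_optimal H A b c x y s.
Proof.
move=> opt; have xs := QP_optimal_gap0 opt; case: opt => Ax eqc x0 s0 _.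
split=> // x' y' s' [eqc' s'0]; rewrite /dual_obj.
have := dotv_ge0 x0 s'0; have := psd_cross x x'.
by have := dotv_c Ax eqc; rewrite (dotv_c Ax eqc') xs; lra.
Qed.

Lemma min_pos_le (u : 'cV[R]_n) i : 0 < u i 0 -> (min_pos u <= (u i 0)%:E)%E.
Proof.
by move=> ui; rewrite /min_pos (bigD1 i) ?inE//= ge_min lexx.
Qed.

Lemma psi_le_primal {x y s} (opt : QP_optimal H A b c x y s) i :
  0 < x i 0 -> (psi H A b c <= (x i 0)%:E)%E.
Proof.
move=> /min_pos_le; apply: le_trans; rewrite /psi ge_min; apply/orP; left.
by apply: ereal_inf_lbound; exists x => //; exact: QP_optimal_primal opt.
Qed.

Lemma psi_le_dual {x y s} (opt : QP_optimal H A b c x y s) i :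
  0 < s i 0 -> (psi H A b c <= (s i 0)%:E)%E.
Proof.
move=> /min_pos_le; apply: le_trans; rewrite /psi ge_min; apply/orP; right.
by apply: ereal_inf_lbound; exists (y, s) => //; exists x;
  exact: QP_optimal_dual opt.
Qed.

End Optimality.

Lemma ge_idx_half (R : realType) (n : nat) (p : \bar R) (u v : 'cV[R]_n) :
  nonneg v -> (forall i, 0 < v i 0 -> (p <= (v i 0)%:E)%E) ->
  ((enorm (u - v))%:E < p / 2%:E)%E ->
  ge_idx (p / 2%:E)%E u = pos_idx v.
Proof.
move=> v0 pv uv; apply/setP => i; rewrite !inE.
have dist : ((`|u i 0 - v i 0|)%:E < p / 2%:E)%E.
  apply: le_lt_trans uv; rewrite lee_fin.
  by have := le_enorm (u - v) i; rewrite !mxE.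
(* A zero entry of [v] leaves [u i 0] below [p / 2]; a positive one is at least [p], so [u i 0]
   stays above [p - p / 2]. *)
have := v0 i; rewrite le_eqVlt => /predU1P[vi0|vi].
  rewrite -vi0 subr0 ltxx in dist *.
  apply/negbTE; rewrite -ltNge; apply: le_lt_trans dist.
  by rewrite lee_fin ler_norm.
(* Only a finite [p] survives: [+oo] cannot lie below the real [v i 0], and for [-oo] no distance is
   less than [p / 2]. *)
rewrite vi; move: dist (pv _ vi); case: p {pv uv} => [p| |].
- rewrite inver ifF ?pnatr_eq0// -EFinM lte_fin !lee_fin ltr_norml.
  by move=> /andP[]; lra.
- by rewrite leye_eq.
- by rewrite inver ifF ?pnatr_eq0// gt0_mulNye ?lte_fin ?invr_gt0.
Qed.

(** Supplies [0 < n], hence [0 < C2 n gamma], from a nonzero [lam]. *)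
Lemma enorm_gt0_dim (R : realType) (n : nat) (u : 'cV[R]_n) :
  0 < enorm u -> (0 < n)%N.
Proof.
by case: n u => // u; rewrite /enorm dotvE big_ord0 sqrtr0 ltxx.
Qed.

Lemma error_bound_lt (R : realType) (n : nat) (p : \bar R) (tau gamma : R)
    (lam x s : 'cV[R]_n) :
  (0 < p)%E -> 0 < tau -> 0 < gamma -> 0 < enorm lam -> 0 < mu lam x s ->
  ((enorm lam)%:E < mine 1 (p / (16 * tau)%:E))%E ->
  ((mu lam x s)%:E < mine 1 ((p / (4 * tau * C2 n gamma)%:E) ^+ 2))%E ->
  ((tau * beta gamma lam x s)%:E < p / 2%:E)%E.
Proof.
move=> p0 tau0 g0 lam0 mu0; rewrite !lt_min !lte_fin.
move=> /andP[lam1 lamp] /andP[mu1 mup].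
have sq1 : Num.sqrt (mu lam x s) < 1 by rewrite -sqrtr1 ltr_sqrt.
have C20 : 0 < C2 n gamma.
  rewrite /C2 ltr_wpDl ?sqrtr_ge0// ltr0n; exact: enorm_gt0_dim lam0.
have d0 : 0 < 4 * tau * C2 n gamma by rewrite !mulr_gt0.
have t0 : 0 < 16 * tau by rewrite mulr_gt0.
(* Both [sqrt mu] and the norm of [lam] are below 1, so the two maxima in [beta] equal 1. *)
rewrite /beta (max_r (ltW sq1)) (max_r (ltW lam1)) !mulr1.
move: p0 lamp mup; case: p => [p| |]//; rewrite !inver !gt_eqF//.
  rewrite -!EFinM expe2 -EFinM !lte_fin => p0.
  rewrite ltr_pdivlMr// => lamp mup.
  have : Num.sqrt (mu lam x s) < p / (4 * tau * C2 n gamma).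
    have q0 : 0 < p / (4 * tau * C2 n gamma) by rewrite divr_gt0.
    by rewrite -(gtr0_norm q0) -sqrtr_sqr ltr_sqrt ?exprn_gt0// expr2.
  rewrite ltr_pdivlMr//.
  (* Regrouped so that each summand in the numerator is one of the quantities just bounded by [p];
     the total is below [(p + p) / 4]. *)
  have -> : tau * (C2 n gamma * Num.sqrt (mu lam x s) + 4 * enorm lam)
    = (Num.sqrt (mu lam x s) * (4 * tau * C2 n gamma)
       + enorm lam * (16 * tau)) / 4 by field.
  lra.
by move=> _ _ _; rewrite gt0_mulye ?lte_fin ?invr_gt0// ltry.
Qed.

Theorem theorem11 (R : realType) (m n : nat)
    (H : 'M[R]_n) (A : 'M[R]_(m, n)) (b : 'cV[R]_m) (c : 'cV[R]_n)
    (hmn : (m <= n)%N) (hH : sym_psd H)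
    (hopt : exists x y s, QP_optimal H A b c x y s)
    (gamma : R) (hgamma : 0 < gamma < 1)
    (taup taud : R) (htau : error_bound_constants H A b c taup taud)
    (hpsi : (0 < psi H A b c)%E)
    (C : \bar R) (hC : C = (psi H A b c / 2%:E)%E)
    (lam : 'cV[R]_n) (hlam : nonneg lam)
    (hlam0 : 0 < enorm lam)
    (hlam1 : ((enorm lam)%:E <
              mine 1 (psi H A b c / (16 * Num.max taup taud)%:E))%E)
    (x : 'cV[R]_n) (y : 'cV[R]_m) (s : 'cV[R]_n)
    (hN : nbhd H A b c gamma lam x y s)
    (hmu0 : 0 < mu lam x s)
    (hmu1 : ((mu lam x s)%:E <
             mine 1 ((psi H A b c / (4 * Num.max taup taud * C2 n gamma)%:E)
                       ^+ 2))%E) :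
  exists (xo : 'cV[R]_n) (yo : 'cV[R]_m) (so : 'cV[R]_n),
    [/\ QP_optimal H A b c xo yo so,
        ge_idx C s = pos_idx so,
        ge_idx C x = pos_idx xo
      & lt_idx C x s = zero_idx xo so].
Proof.
have /andP[gamma0 _] := hgamma.
have [taup0 taud0 bound] := htau.
have [xo [yo [so [opt dx ds]]]] := bound _ _ _ _ _ hgamma hlam hN.
have tau0 : 0 < Num.max taup taud by rewrite lt_max taup0.
have small := error_bound_lt hpsi tau0 gamma0 hlam0 hmu0 hlam1 hmu1.
(* The sign is read off the error bound itself, as a norm is below [taup * beta]; it allows [taup]
   and [taud] to be replaced by their maximum. *)
have beta_ge0 : 0 <= beta gamma lam x s.
  by rewrite -(pmulr_rge0 _ taup0) (le_trans _ (ltW dx))// sqrtr_ge0.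
have close u v (t : R) : enorm (u - v) < t * beta gamma lam x s ->
    t <= Num.max taup taud -> ((enorm (u - v))%:E < C)%E.
  move=> uv ttau; rewrite hC; apply: lt_trans small; rewrite lte_fin.
  by apply: lt_le_trans uv _; rewrite ler_wpM2r.
have [_ _ xo0 so0 _] := opt.
have Ix : ge_idx C x = pos_idx xo.
  rewrite hC; apply: ge_idx_half => //; first exact: psi_le_primal opt.
  by rewrite -hC; apply: close dx _; rewrite le_max lexx.
have Ss : ge_idx C s = pos_idx so.
  rewrite hC; apply: ge_idx_half => //; first exact: psi_le_dual opt.
  by rewrite -hC; apply: close ds _; rewrite le_max lexx orbT.
by exists xo, yo, so; split=> //; rewrite /lt_idx /zero_idx Ix Ss.
Qed.
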